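(* $\mathrm{sat}^*(n,\mathcal D_2)=\Theta(n)$.
   Context: $\mathcal D_2$ is the diamond poset: 4 elements, one minimal, one maximal, two incomparable middle elements. A family $\mathcal F\subseteq\mathcal P([n])$ (ordered by inclusion) contains an induced copy of a poset $\mathcal P$ if there is an injection $f:\mathcal P\to\mathcal F$ that is an isomorphism of $\mathcal P$ onto $f(\mathcal P)$ with the inclusion order. $\mathcal F$ is $\mathcal P$-saturated if it contains no induced copy of $\mathcal P$ but for every $S\in\mathcal P([n])\setminus\mathcal F$ the family $\mathcal F\cup\{S\}$ does. $\mathrm{sat}^*(n,\mathcal P)$ is the minimum size of a $\mathcal P$-saturated family in $\mathcal P([n])$. *)

(* Defs.v *)
From HB Require Import structures.
From mathcomp Require Import all_boot all_order all_algebra.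
From mathcomp Require Import all_classical all_reals all_analysis.

Set Implicit Arguments.
Unset Strict Implicit.
Unset Printing Implicit Defensive.

Import Order.Theory GRing.Theory Num.Theory.
Import numFieldNormedType.Exports.

Local Open Scope nat_scope.

(* The diamond: the product order on bool * bool, with false < true.
   diamondE below spells out the order relation. *)
Definition diamond : finPOrderType _ := (bool *p bool)%type.

Section Saturation.
Variables (d : Order.disp_t) (P : finPOrderType d) (n : nat).
Implicit Types F : {set {set 'I_n}}.

Definition has_induced_copy F : bool :=
  [exists f : {ffun P -> {set 'I_n}},
    [&& injectiveb f, [forall x, f x \in F] &
        [forall x, forall y, (f x \subset f y) == (x <= y)%O]]].

Definition saturated F : bool :=
  ~~ has_induced_copy F &&
  [forall S : {set 'I_n}, (S \notin F) ==> has_induced_copy (S |: F)].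

(* The idle value 2 ^ n is the size of the largest family, so it does not
   affect the minimum as soon as a saturated family exists, which is the case
   for every nonempty P (sat_starP). *)
Definition sat_star : nat :=
  \big[minn/2 ^ n]_(F : {set {set 'I_n}} | saturated F) #|F|.

Lemma has_induced_copyP F :
  reflect (exists f : P -> {set 'I_n},
             [/\ injective f, forall x, f x \in F &
                 forall x y, (f x \subset f y) = (x <= y)%O])
          (has_induced_copy F).
Proof.
apply: (iffP existsP) => [[f /and3P[/injectiveP fI /forallP fF /forallP fO]]|].
  by exists f; split=> // x y; apply/eqP; move/forallP: (fO x).
case=> f [fI fF fO]; exists [ffun x => f x]; apply/and3P; split.
- by apply/injectiveP => x y; rewrite !ffunE => /fI.
- by apply/forallP => x; rewrite ffunE.
- by apply/forallP => x; apply/forallP => y; rewrite !ffunE fO.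
Qed.

Lemma saturated_exists : 0 < #|P| -> exists F, saturated F.
Proof.
case/card_gt0P=> x0 _.
have free0 : ~~ has_induced_copy finset.set0.
  by apply/has_induced_copyP => -[f [_ /(_ x0)]]; rewrite inE.
case: (@arg_maxnP _ finset.set0 (fun F => ~~ has_induced_copy F)
         (fun F => #|F|) free0) => F freeF maxF.
exists F; rewrite /saturated freeF; apply/forallP => S; apply/implyP => SF.
apply: contraT => /maxF; rewrite cardsU1 SF add1n.
by rewrite /= leqNgt leqnn.
Qed.

Lemma sat_starP : 0 < #|P| ->
  (exists2 F, saturated F & #|F| = sat_star) /\
  (forall F, saturated F -> sat_star <= #|F|).
Proof.
move=> /saturated_exists[F0 satF0].
have lb F : saturated F -> sat_star <= #|F|.
  move=> satF; have := bigmin_le_cond (2 ^ n) (fun G : {set {set 'I_n}} => #|G|) satF.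
  by rewrite minEnat leEnat.
split=> //.
case: (@arg_minnP _ F0 saturated (fun F => #|F|) satF0) => F satF minF.
exists F => //; apply/eqP; rewrite eqn_leq lb // andbT /sat_star.
elim/big_ind: _ => [|a b Fa Fb|G /minF //].
  by rewrite (leq_trans (max_card _)) //= -cardsT -powersetT card_powerset
             cardsT card_ord.
by rewrite leq_min Fa.
Qed.

End Saturation.

Arguments has_induced_copy {d} P {n} F.
Arguments saturated {d} P {n} F.
Arguments sat_star {d} P n.

Lemma card_diamond : #|diamond| = 4.
Proof. by rewrite card_prod card_bool. Qed.

Lemma diamondE (x y : diamond) :
  (x <= y)%O = [|| x == y, x == (false, false) | y == (true, true)].
Proof. by case: x y => [[] []] [[] []]. Qed.

(* Main.v *)
(* Lower bound: if #|F| + 1 < n, linear algebra gives a nonzero vector x in Q^n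
   that sums to zero on [n] and on every member of the saturated family F.
   Saturation shows that every set meeting all members of F contains a union of
   two complements of members which still meets all of them. As x sums to zero
   on these complements, this forces x to vanish on the minimal members of F
   and, dually, outside the maximal ones. For any other i, a maximal A among
   the members avoiding i has i |: A in F as well, so x i = 0 again.
   Upper bound: the sets with at most one element form a saturated family. *)
Require Import Defs.
From mathcomp Require Import all_classical all_reals all_analysis.
From mathcomp Require Import all_boot all_order all_algebra zify.

Set Implicit Arguments.
Unset Strict Implicit.
Unset Printing Implicit Defensive.

Import Order.TTheory GRing.Theory Num.Theory.

Section Diamonds.
Variable T : finType.
Implicit Types (F : {set {set T}}) (L A B U S : {set T}).

Definition is_diamond L A B U : bool :=
  [&& L \subset A :&: B, A :|: B \subset U, ~~ (A \subset B) &
      ~~ (B \subset A)].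

Definition has_diamond F : Prop := exists L A B U,
  [/\ L \in F, A \in F, B \in F, U \in F & is_diamond L A B U].

Definition diamond_saturated F : Prop :=
  ~ has_diamond F /\ forall S, S \notin F -> has_diamond (S |: F).

Lemma is_diamondC L A B U : is_diamond L A B U = is_diamond L B A U.
Proof. by rewrite /is_diamond setIC setUC [~~ _ && _]andbC. Qed.

Lemma is_diamond_proper L A B U : is_diamond L A B U ->
  [/\ L \proper A, L \proper B, A \proper U & B \proper U].
Proof.
case/and4P; rewrite subsetI subUset => /andP[LA LB] /andP[AU BU] nAB nBA.
by rewrite !properE LA LB AU BU /=; split;
  [ apply: contra nAB => /subset_trans->
  | apply: contra nBA => /subset_trans->
  | apply: contra nBA; apply: subset_trans
  | apply: contra nAB; apply: subset_trans ].
Qed.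

Lemma is_diamond_uniq L A B U : is_diamond L A B U -> uniq [:: L; A; B; U].
Proof.
move=> dia; have [LA LB AU BU] := is_diamond_proper dia.
have /and4P[_ _ nAB _] := dia.
rewrite /= !inE !negb_or (proper_neq LA) (proper_neq LB) (proper_neq AU).
rewrite (proper_neq BU) (proper_neq (proper_trans LA AU)) !andbT /=.
by apply: contraNneq nAB => ->.
Qed.

Definition diamond_bottom F S : Prop := exists A B U,
  [/\ A \in F, B \in F, U \in F & is_diamond S A B U].

Definition diamond_middle F S : Prop := exists L B U,
  [/\ L \in F, B \in F, U \in F & is_diamond L S B U].

Definition diamond_top F S : Prop := exists L A B,
  [/\ L \in F, A \in F, B \in F & is_diamond L A B S].

Lemma has_diamondU1 F S : ~ has_diamond F -> has_diamond (S |: F) ->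
  [\/ diamond_bottom F S, diamond_middle F S | diamond_top F S].
Proof.
move=> free [L [A [B [U [LF AF BF UF dia]]]]].
have := is_diamond_uniq dia; rewrite /= !inE !negb_or.
case/and3P=> /and3P[LA LB LU] /andP[AB AU] /andP[BU _].
have memF X : X \in S |: F -> S != X -> X \in F.
  by rewrite in_setU1 => /predU1P[->|//]; rewrite eqxx.
case: (eqVneq S L) => [SL|/(memF _ LF) {}LF].
  by constructor 1; exists A, B, U; rewrite !memF // SL.
case: (eqVneq S A) => [SA|/(memF _ AF) {}AF].
  by constructor 2; exists L, B, U; rewrite LF !memF // SA.
case: (eqVneq S B) => [SB|/(memF _ BF) {}BF].
  by constructor 2; exists L, A, U; rewrite is_diamondC LF AF memF // SB.
case: (eqVneq S U) => [SU|/(memF _ UF) {}UF].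
  by constructor 3; exists L, A, B; rewrite LF AF BF SU.
by case: free; exists L, A, B, U.
Qed.

Lemma diamond_bottom_supset F L S :
  L \in F -> L \subset S -> diamond_bottom F S -> has_diamond F.
Proof.
move=> LF LS [A [B [U [AF BF UF /and4P[SAB ABU nAB nBA]]]]].
by exists L, A, B, U; rewrite /is_diamond (subset_trans LS) // ABU nAB.
Qed.

Lemma diamond_top_subset F U S :
  U \in F -> S \subset U -> diamond_top F S -> has_diamond F.
Proof.
move=> UF SU [L [A [B [LF AF BF /and4P[LAB ABS nAB nBA]]]]].
by exists L, A, B, U; rewrite /is_diamond LAB (subset_trans ABS) // nAB.
Qed.

Lemma diamond_saturated_neq0 F : diamond_saturated F -> F != set0.
Proof.
case=> _ sat; apply/eqP=> F0; have := sat set0; rewrite F0 setU0 inE.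
case=> // L [A [B [U [_ /set1P-> /set1P-> _ /is_diamond_uniq]]]].
by rewrite /= !inE eqxx andbF.
Qed.

Definition setC_family F : {set {set T}} := @setC T @^-1: F.

Lemma setC_familyK F : setC_family (setC_family F) = F.
Proof. by apply/setP=> A; rewrite !inE setCK. Qed.

Lemma setC_familyU1 F S : setC_family (S |: F) = ~: S |: setC_family F.
Proof. by apply/setP=> A; rewrite !inE (inv_eq setCK). Qed.

Lemma is_diamond_setC L A B U :
  is_diamond (~: U) (~: A) (~: B) (~: L) = is_diamond L A B U.
Proof.
rewrite /is_diamond -setCU -setCI !setCS andbCA.
by rewrite [~~ (B \subset A) && _]andbC.
Qed.

Lemma has_diamond_setC F : has_diamond (setC_family F) -> has_diamond F.
Proof.
case=> L [A [B [U [LF AF BF UF dia]]]]; rewrite !inE in LF AF BF UF.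
by exists (~: U), (~: A), (~: B), (~: L); rewrite is_diamond_setC.
Qed.

Lemma diamond_saturated_setC F :
  diamond_saturated F -> diamond_saturated (setC_family F).
Proof.
case=> free sat; split=> [/has_diamond_setC // | S].
rewrite inE => SF; apply: has_diamond_setC.
by rewrite setC_familyU1 setC_familyK; apply: sat.
Qed.

Lemma maxset_setC_family F A :
  maxset [in F] A = minset [in setC_family F] (~: A).
Proof. by rewrite maxminset; apply: minset_eq => B; rewrite !inE. Qed.

End Diamonds.

Section Transversals.
Variable T : finType.
Implicit Types (F : {set {set T}}) (A B H P Y : {set T}) (i : T).

Definition transversal_of F Y : bool :=
  [forall A in F, ~~ [disjoint A & Y]].

Lemma transversal_of_setC F Y :
  transversal_of F (~: Y) = [forall A in F, ~~ (A \subset Y)].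
Proof. by apply: eq_forallb => A; rewrite disjoints_subset setCK. Qed.

Lemma mem_minset_transversal F H i : minset [in F] H -> i \in H ->
  exists2 P, minset (transversal_of F) P & i \in P.
Proof.
case/minsetP=> /= HF Hmin iH.
have trH : transversal_of F (~: (H :\ i)).
  rewrite transversal_of_setC; apply/forall_inP=> A AF; apply/negP=> AH.
  have AE : A = H by apply: Hmin => //; apply: subset_trans AH (subD1set _ _).
  by have := subsetP AH i; rewrite AE !inE eqxx iH => /(_ isT).
have [P Pmin PH] := minset_exists trH; exists P => //.
have /forall_inP/(_ H HF) := minsetp Pmin.
apply: contraNT => iP; rewrite disjoints_subset; apply/subsetP=> j jH.
rewrite inE; apply/negP=> jP; have := subsetP PH _ jP.
by rewrite !inE jH andbT negbK => /eqP ji; rewrite -ji jP in iP.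
Qed.

(* The complement of Y contains no member of F, so it can only be the bottom of
   a diamond; diamond-freeness then keeps F out of the subsets of A :&: B. *)
Lemma transversal_saturated F Y : diamond_saturated F -> transversal_of F Y ->
  exists A B, [/\ A \in F, B \in F, ~: A :|: ~: B \subset Y &
                  transversal_of F (~: A :|: ~: B)].
Proof.
move=> [free sat]; rewrite -{1}[Y]setCK transversal_of_setC => /forall_inP nF.
have YF : ~: Y \notin F by apply/negP=> /nF; rewrite subxx.
case: (has_diamondU1 free (sat _ YF)).
- case=> A [B [U [AF BF UF /and4P[YAB ABU nAB nBA]]]].
  exists A, B; rewrite -setCI; split=> //; first by rewrite subCset.
  rewrite transversal_of_setC; apply/forall_inP=> L LF; apply/negP=> LAB.
  by case: free; exists L, A, B, U; rewrite /is_diamond LAB ABU nAB nBA.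
- case=> L [B [U [/nF LY _ _ /is_diamond_proper[/proper_sub]]]].
  by rewrite (negPf LY).
- case=> L [A [B [_ /nF AY _ /is_diamond_proper[_ _ /proper_sub]]]].
  by rewrite (negPf AY).
Qed.

End Transversals.

Section AddingPoint.
Variable T : finType.
Implicit Types (F : {set {set T}}) (A B H K : {set T}) (i : T).

Lemma diamond_middle_setU1 F i A :
    (forall H, minset [in F] H -> i \notin H) ->
    maxset [pred B in F | i \notin B] A -> diamond_middle F (i |: A) ->
  has_diamond F.
Proof.
move=> Hmin /maxsetP[/= /andP[AF iA] Amax] [L [B [U [LF BF UF]]]].
case/and4P; rewrite subsetI !subUset => /andP[LS LB] /andP[/andP[iU AU] BU].
move=> nSB nBS.
have subA H : H \subset i |: A -> i \notin H -> H \subset A.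
  by move=> HS iH; rewrite -(setU1K iA) subsetD1 HS.
have [iL|iL] := boolP (i \in L).
- have [H Hm HL] := minset_exists (P := [in F]) LF.
  have HA : H \subset A by rewrite subA ?(Hmin _ Hm) ?(subset_trans HL).
  have nAL : ~~ (A \subset L).
    apply: contra nSB => AL; rewrite sub1set (subsetP LB) //=.
    exact: subset_trans LB.
  have nLA : ~~ (L \subset A) by apply: contra iA => /subsetP->.
  exists H, A, L, U; split=> //; first exact: (minsetp Hm).
  by rewrite /is_diamond subsetI HA HL subUset AU (subset_trans LB) // nAL.
- have nAB : ~~ (A \subset B).
    apply: contra nSB => AB; rewrite AB andbT sub1set; apply: contraT => iB.
    by rewrite (Amax B) ?BF // subsetUr in nBS.
  have nBA : ~~ (B \subset A).
    by apply: contra nBS => /subset_trans->; rewrite ?subsetUr.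
  exists L, A, B, U; split=> //.
  by rewrite /is_diamond subsetI subA // LB subUset AU BU nAB.
Qed.

Lemma saturated_exists_setU1 F i : diamond_saturated F ->
    (forall H, minset [in F] H -> i \notin H) ->
    (forall K, maxset [in F] K -> i \in K) ->
  exists A, [/\ A \in F, i |: A \in F & i \notin A].
Proof.
move=> satF Hmin Kmax; have [free sat] := satF.
have [A0 A0F] := set0Pn _ (diamond_saturated_neq0 satF).
have [H Hm _] := minset_exists (P := [in F]) A0F.
have avoidH : [pred A in F | i \notin A] H.
  by rewrite /= (minsetp Hm) (Hmin _ Hm).
have [A Am _] := maxset_exists avoidH.
have /andP[/= AF iA] := maxsetp Am.
exists A; split=> //; apply: contraT => SF.
case: (has_diamondU1 free (sat _ SF)) => S_role; case: free.
- by apply: diamond_bottom_supset AF _ S_role; apply: subsetUr.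
- exact: diamond_middle_setU1 Am S_role.
- have [K Km AK] := maxset_exists (P := [in F]) AF.
  apply: diamond_top_subset (maxsetp Km) _ S_role.
  by rewrite subUset sub1set (Kmax _ Km).
Qed.

End AddingPoint.

Local Open Scope ring_scope.

Section Weights.
Variables (T : finType) (V : nmodType) (x : T -> V).
Implicit Types (F : {set {set T}}) (A : {set T}).

Definition weight A : V := \sum_(j in A) x j.

Lemma weightC A : weight setT = weight A + weight (~: A).
Proof. by rewrite /weight (big_setID A) /= setTI setTD. Qed.

Lemma weightU1 i A : i \notin A -> weight (i |: A) = x i + weight A.
Proof. by move=> iA; rewrite /weight big_setU1. Qed.

Definition balanced F : Prop := {in F, forall A, weight A = 0}.

Lemma balanced_setC F :
  weight setT = 0 -> balanced F -> balanced (setC_family F).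
Proof.
move=> xT xF A; rewrite inE => /xF xCA.
by rewrite -[LHS]addr0 -[X in _ + X]xCA -weightC.
Qed.

End Weights.

Lemma exists_balanced (T : finType) (K : fieldType) (F : {set {set T}}) :
  (#|F| < #|T|)%N -> exists2 x : T -> K, balanced x F & exists i, x i != 0.
Proof.
move=> ltFT.
pose M : 'M[K]_(#|T|, #|F|) :=
  \matrix_(i, k) (enum_val i \in (enum_val k : {set T}))%:R.
have : kermx M != 0.
  by rewrite kermx_eq0 /row_free neq_ltn (leq_ltn_trans _ ltFT) ?rank_leq_col.
case/rowV0Pn=> v /sub_kermxP vM /rV0Pn[i vi].
exists (fun t => v 0 (enum_rank t)); last first.
  by exists (enum_val i); rewrite enum_valK.
move=> A AF; have /rowP/(_ (enum_rank_in AF A)) := vM; rewrite !mxE => vMA.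
rewrite -[RHS]vMA /weight big_mkcond big_enum_val; apply: eq_bigr => j _.
by rewrite mxE enum_rankK_in // enum_valK mulr_natr mulrb.
Qed.

Section Zeros.
Variables (T : finType) (R : realDomainType).
Implicit Types (x : T -> R) (F : {set {set T}}) (A P : {set T}).

Definition zeros x : {set T} := [set j | x j == 0].
Definition positives x : {set T} := [set j | 0 < x j].

Lemma weight0_sub_zeros x A :
  {in A, forall j, 0 <= x j} -> weight x A = 0 -> A \subset zeros x.
Proof.
by move=> x0 /(psumr_eq0P x0) xA; apply/subsetP=> j /xA/eqP; rewrite inE.
Qed.

Lemma zerosN x : zeros (\- x) = zeros x.
Proof. by apply/setP=> j; rewrite !inE oppr_eq0. Qed.

Lemma weightN x A : weight (\- x) A = - weight x A.
Proof. exact: sumrN. Qed.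

Lemma transversal_zeros_positives x F P : balanced x F -> transversal_of F P ->
  transversal_of F ((P :&: zeros x) :|: positives x).
Proof.
move=> xF /forall_inP trP; apply/forall_inP=> A AF.
apply: contra (trP _ AF); rewrite !disjoints_subset setCU subsetI.
case/andP=> APZ Apos.
have AZ : A \subset zeros x.
  rewrite -zerosN; apply: weight0_sub_zeros; last by rewrite weightN xF ?oppr0.
  by move=> j /(subsetP Apos); rewrite !inE oppr_ge0 -leNgt.
apply/subsetP=> j jA; have := subsetP APZ j jA.
by rewrite setCI in_setU [j \in ~: zeros x]in_setC (subsetP AZ) ?orbF.
Qed.

Section BalancedSaturated.
Variables (F : {set {set T}}) (x : T -> R).
Hypotheses (satF : diamond_saturated F) (xT : weight x setT = 0).
Hypothesis xF : balanced x F.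

(* As in Seymour's bound for critically non-2-colourable hypergraphs: swapping
   the nonzero part of P for the positive support of x keeps a transversal, and
   minimality of P then leaves no room for a nonzero part. *)
Lemma minset_transversal_sub_zeros P :
  minset (transversal_of F) P -> P \subset zeros x.
Proof.
case/minsetP=> trP Pmin.
have trY := transversal_zeros_positives xF trP.
have [A [B [AF BF]]] := transversal_saturated satF trY.
rewrite subUset => /andP[AY BY] trAB.
have sub_PZ C : C \in F ->
    ~: C \subset (P :&: zeros x) :|: positives x -> ~: C \subset P :&: zeros x.
  move=> CF CY; have CZ : ~: C \subset zeros x.
    apply: weight0_sub_zeros => [j /(subsetP CY)|].
      by rewrite !inE => /orP[/andP[_ /eqP->]|/ltW].
    by rewrite (balanced_setC xT xF) // inE setCK.
  apply/subsetP=> j jC; have := subsetP CY j jC; have := subsetP CZ j jC.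
  by rewrite !inE => /eqP->; rewrite eqxx ltxx orbF.
have ABPZ : ~: A :|: ~: B \subset P :&: zeros x by rewrite subUset !sub_PZ.
rewrite -(Pmin _ trAB) ?(subset_trans ABPZ) ?subsetIl //.
exact: subsetIr.
Qed.

Lemma minset_sub_zeros H : minset [in F] H -> H \subset zeros x.
Proof.
move=> Hm; apply/subsetP=> i /(mem_minset_transversal Hm)[P Pm].
exact: subsetP (minset_transversal_sub_zeros Pm) i.
Qed.

End BalancedSaturated.

Lemma balanced_saturated_eq0 F x :
  diamond_saturated F -> weight x setT = 0 -> balanced x F -> x =1 (fun=> 0).
Proof.
move=> satF xT xF i; apply/eqP; apply: contraT => xi.
have iZ : i \notin zeros x by rewrite inE.
have [H Hm|K Km|A [AF iAF iA]] := saturated_exists_setU1 (i := i) satF.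
- by apply: contra iZ; apply: subsetP (minset_sub_zeros satF xT xF Hm) i.
- rewrite maxset_setC_family in Km; apply: contraR iZ; rewrite -in_setC.
  apply/subsetP/(minset_sub_zeros (diamond_saturated_setC satF) xT _ Km).
  exact: balanced_setC.
- by rewrite -(xF _ iAF) weightU1 // (xF _ AF) addr0 eqxx in xi.
Qed.

End Zeros.

Local Close Scope ring_scope.

Lemma leq_card_diamond_saturated (T : finType) (F : {set {set T}}) :
  diamond_saturated F -> #|T| <= #|F|.+1.
Proof.
move=> satF; rewrite leqNgt; apply/negP=> ltFT.
have [|x xTF [i]] := @exists_balanced T rat (setT |: F).
  by apply: leq_ltn_trans ltFT; rewrite cardsU1; case: (_ \in _).
rewrite (balanced_saturated_eq0 satF) ?eqxx //; first exact: xTF (setU11 _ _).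
by move=> A AF; apply/xTF/setU1r.
Qed.

Section Subsingletons.
Variable T : finType.

Definition subsingletons : {set {set T}} := [set A : {set T} | #|A| <= 1].

Lemma card_subsingletons : #|subsingletons| = #|T|.+1.
Proof.
have -> : subsingletons = set0 |: [set [set i] | i in T].
  apply/setP=> A; rewrite !inE leq_eqVlt ltnS leqn0 cards_eq0 orbC.
  congr (_ || _); apply/cards1P/imsetP=> [[i ->]|[i _ ->]]; by exists i.
rewrite cardsU1 card_imset; last exact: set1_inj.
by case: imsetP => // -[i _ /setP/(_ i)]; rewrite !inE eqxx.
Qed.

Lemma subsingletons_saturated : diamond_saturated subsingletons.
Proof.
split=> [[L [A [B [U [_ _ _]]]]]|S].
  rewrite inE leqNgt => /negP U1 /is_diamond_proper[LA _ AU _]; apply: U1.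
  apply: leq_ltn_trans (proper_card AU).
  exact: leq_ltn_trans (proper_card LA).
rewrite inE -ltnNge => /card_gt1P[i [j [iS jS ij]]].
exists set0, [set i], [set j], S; rewrite !inE cards0 !cards1 eqxx !orbT.
by rewrite /is_diamond sub0set subUset !sub1set iS jS !inE ij eq_sym ij.
Qed.

End Subsingletons.

Lemma has_induced_copy_diamondP n (F : {set {set 'I_n}}) :
  reflect (has_diamond F) (has_induced_copy diamond F).
Proof.
apply: (iffP (has_induced_copyP _ _)) => [[f [_ fF fO]]|].
  exists (f (false, false)), (f (true, false)).
  exists (f (false, true)), (f (true, true)).
  by rewrite /is_diamond subsetI subUset !fO !diamondE.
case=> L [A [B [U [LF AF BF UF dia]]]].
have [LA LB AU BU] := is_diamond_proper dia; have /and4P[_ _ nAB nBA] := dia.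
pose f (p : diamond) := match p with
  | (false, false) => L | (true, false) => A
  | (false, true) => B | (true, true) => U end.
have fO p q : (f p \subset f q) = (p <= q)%O.
  have proper_subsetE (X Y : {set 'I_n}) :
      X \proper Y -> ((X \subset Y) = true) * ((Y \subset X) = false).
    by case/andP=> -> /negPf.
  have [EA EB] := (proper_subsetE _ _ LA, proper_subsetE _ _ LB).
  have [EAU EBU] := (proper_subsetE _ _ AU, proper_subsetE _ _ BU).
  have ELU := proper_subsetE _ _ (proper_trans LA AU).
  rewrite diamondE; case: p q => [[] []] [[] []] /=;
    by rewrite ?subxx ?(EA, EB, EAU, EBU, ELU) ?(negPf nAB) ?(negPf nBA).
exists f; split=> // [p q fpq|[[] []] //].
by apply/le_anti; rewrite -!fO fpq subxx.
Qed.

Lemma saturated_diamondP n (F : {set {set 'I_n}}) :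
  reflect (diamond_saturated F) (saturated diamond F).
Proof.
apply: (iffP andP) => -[free sat]; split.
- exact: elimN (has_induced_copy_diamondP F) free.
- move=> S SF; apply/has_induced_copy_diamondP.
  exact: implyP (forallP sat S) SF.
- exact: introN (has_induced_copy_diamondP F) free.
- by apply/forallP=> S; apply/implyP=> /sat/has_induced_copy_diamondP.
Qed.

Lemma sat_star_diamond_bounds n :
  n <= (sat_star diamond n).+1 /\ sat_star diamond n <= n.+1.
Proof.
have [|[F /saturated_diamondP satF <-] lb] := @sat_starP _ diamond n.
  by rewrite card_diamond.
split; first by have := leq_card_diamond_saturated satF; rewrite card_ord.
have := card_subsingletons 'I_n; rewrite card_ord => <-; apply: lb.
exact/saturated_diamondP/subsingletons_saturated.
Qed.

Local Open Scope classical_set_scope.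
Local Open Scope ring_scope.

Lemma eqTheta_natr_shift (R : realType) (u : nat -> nat) (k : nat) :
    (forall n, n <= u n + k)%N -> (forall n, u n <= n + k)%N ->
  (fun n => (u n)%:R : R^o) =Theta_\oo (fun n => n%:R : R^o).
Proof.
move=> lb ub; rewrite eqThetaE; apply/asboolP.
exists (2^-1, 2) => /=; first by rewrite invr_gt0 !ltr0n.
near=> n; have le2kn : (k.*2 <= n)%N by near: n; exists k.*2.
rewrite !normr_nat mulrC ler_pdivrMr ?ltr0n // -!natrM !ler_nat.
by have := lb n; have := ub n; split; lia.
Unshelve. all: by end_near.
Qed.

Theorem theorem2 (R : realType) :
  (fun n : nat => (sat_star diamond n)%:R : R^o) =Theta_\oo
  (fun n : nat => n%:R : R^o).
Proof.
apply: (@eqTheta_natr_shift R _ 1) => n; rewrite addn1.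
- exact: (sat_star_diamond_bounds n).1.
- exact: (sat_star_diamond_bounds n).2.
Qed.
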